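(* Let $\mathcal A$ be a prime unital algebra and let $X$ be an infinite-dimensional Banach space. Let $C \in \mathcal B(X)$ be a fixed finite-rank operator and $D \in \mathcal A$ a fixed element. If $\phi: \mathcal B(X) \to \mathcal A$ is a bijective linear map such that $\phi(A)\phi(B) = D$ whenever $A, B \in \mathcal B(X)$ satisfy $AB = C$, then $\phi(I) = \alpha$ is an invertible element lying in the center of $\mathcal A$, and there exists an isomorphism $\Phi: \mathcal B(X) \to \mathcal A$ such that $\phi(T) = \alpha \Phi(T)$ for all $T \in \mathcal B(X)$.
   Context: Algebras are associative and over $\mathbb{C}$. $X$ is a complex Banach space, $\mathcal B(X)$ is the algebra of bounded linear operators on $X$, and $I$ is the identity operator on $X$. A ring (or algebra) is called prime if the product of any two nonzero ideals is nonzero. No topology on $\mathcal A$ and no continuity of $\phi$ is assumed. ''Isomorphism'' means algebra isomorphism. *)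

(* Defs.v *)
From HB Require Import structures.
From mathcomp Require Import all_boot all_order all_algebra.
From mathcomp Require Import complex.
From mathcomp Require Import boolp classical_sets functions reals topology
  normedtype.

Set Implicit Arguments.
Unset Strict Implicit.
Unset Printing Implicit Defensive.

Import Order.TTheory GRing.Theory Num.Theory.
Import numFieldNormedType.Exports.

Local Open Scope classical_set_scope.
Local Open Scope ring_scope.

Section FiniteDimension.
Context {K : fieldType} {V : lmodType K}.

Definition finite_dimensional (S : set V) : Prop :=
  exists (n : nat) (v : 'I_n -> V),
    S = [set \sum_(i < n) c i *: v i | c in [set: 'I_n -> K]].

End FiniteDimension.

Section PrimeRing.
Context {A : pzRingType}.

Definition two_sided_ideal (J : set A) : Prop :=
  [/\ J 0, forall x y, J x -> J y -> J (x - y),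
      forall a x, J x -> J (a * x) & forall a x, J x -> J (x * a)].

Definition ideal_product (I J : set A) : set A :=
  [set z | exists (n : nat) (x y : 'I_n -> A),
     [/\ forall i, I (x i), forall i, J (y i) & z = \sum_(i < n) x i * y i]].

End PrimeRing.

(* In a unital algebra every two-sided ideal of the underlying ring is stable
   under scalars, so primeness as a ring and as an algebra coincide. *)
Definition prime_ring (A : pzRingType) : Prop :=
  forall I J : set A, two_sided_ideal I -> two_sided_ideal J ->
    I <> [set 0] -> J <> [set 0] -> ideal_product I J <> [set 0].

Section BoundedOperators.
Context {K : numFieldType} (X : normedModType K).

(* The norm of a normedModType K takes its values in K; the inequality forces
   M * `|x| to be a nonnegative real. *)
Definition bounded_linear : {pred X -> X} :=
  fun f => `[< linear f /\ exists M : K, forall x, `|f x| <= M * `|x| >].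

Record bounded_operator := BoundedOperator {
  bounded_operator_fun :> X -> X;
  _ : bounded_operator_fun \in bounded_linear }.

HB.instance Definition _ := [isSub for bounded_operator_fun].
HB.instance Definition _ := [Choice of bounded_operator by <:].

Implicit Types S T U : bounded_operator.

Lemma bounded_linearP (f : X -> X) :
  reflect (linear f /\ exists M : K, forall x, `|f x| <= M * `|x|)
          (f \in bounded_linear).
Proof. exact: asboolP. Qed.

Lemma bounded_linear_submod : subsemimod_closed bounded_linear.
Proof.
split; first split.
- apply/bounded_linearP; split.
    by move=> a x y; rewrite /GRing.zero /= scaler0 addr0.
  by exists 0 => x; rewrite normr0 mul0r.
- move=> f g /bounded_linearP[lf [M fM]] /bounded_linearP[lg [N gN]].
  apply/bounded_linearP; split.
    by move=> a x y; rewrite !fctE lf lg scalerDr addrACA.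
  exists (M + N) => x; rewrite mulrDl.
  by rewrite (le_trans (ler_normD _ _))// lerD.
- move=> a f /bounded_linearP[lf [M fM]]; apply/bounded_linearP; split.
    by move=> b x y; rewrite !fctE lf scalerDr !scalerA mulrC.
  exists (`|a| * M) => x; rewrite !fctE normrZ -mulrA.
  exact: ler_wpM2l.
Qed.

HB.instance Definition _ :=
  GRing.SubChoice_isSubLmodule.Build K (X -> X) bounded_linear
    bounded_operator bounded_linear_submod.

Lemma bounded_operator_linear T : linear T.
Proof. by case: T => f /= /bounded_linearP[]. Qed.

HB.instance Definition _ T :=
  GRing.isLinear.Build K X X *:%R (bounded_operator_fun T)
    (bounded_operator_linear T).

Lemma bounded_operatorP S T : (forall x, S x = T x) -> S = T.
Proof. by move=> ST; apply/val_inj/funext. Qed.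

Lemma bounded_operatorD S T x : (S + T) x = S x + T x.
Proof. by []. Qed.

Lemma bounded_operatorZ (a : K) T x : (a *: T) x = a *: T x.
Proof. by []. Qed.

Lemma bounded_linear_id : id \in bounded_linear.
Proof. by apply/bounded_linearP; split=> //; exists 1 => x; rewrite mul1r. Qed.

Lemma bounded_linear_comp S T : S \o T \in bounded_linear.
Proof.
case: S T => f /= /bounded_linearP[lf [M fM]].
case=> g /= /bounded_linearP[lg [N gN]].
apply/bounded_linearP; split; first by move=> a x y /=; rewrite lg lf.
exists (`|M| * N) => x /=; rewrite -mulrA.
apply: le_trans (ler_wpM2l (normr_ge0 M) (gN x)).
rewrite -[`|g x|]normr_id -normrM ger0_norm//.
exact: le_trans (normr_ge0 _) (fM _).
Qed.

Definition id_operator := BoundedOperator bounded_linear_id.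
Definition comp_operator S T := BoundedOperator (bounded_linear_comp S T).

Fact comp_operatorA : associative comp_operator.
Proof. by move=> S T U; apply: bounded_operatorP. Qed.

Fact comp_id_operator : left_id id_operator comp_operator.
Proof. by move=> T; apply: bounded_operatorP. Qed.

Fact comp_operator_id : right_id id_operator comp_operator.
Proof. by move=> T; apply: bounded_operatorP. Qed.

Fact comp_operatorDl : left_distributive comp_operator +%R.
Proof. by move=> S T U; apply: bounded_operatorP. Qed.

Fact comp_operatorDr : right_distributive comp_operator +%R.
Proof.
by move=> S T U; apply: bounded_operatorP => x; exact: (linearD S).
Qed.

(* When X = 0 the ring has 1 = 0, hence a pzRingType and not an algType. *)
HB.instance Definition _ :=
  GRing.Zmodule_isPzRing.Build bounded_operator comp_operatorA comp_id_operator
    comp_operator_id comp_operatorDl comp_operatorDr.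

Lemma bounded_operator1 x : (1 : bounded_operator) x = x.
Proof. by []. Qed.

Lemma bounded_operatorM S T x : (S * T) x = S (T x).
Proof. by []. Qed.

Definition finite_rank T : Prop := finite_dimensional (range T).

End BoundedOperators.

(* Main.v *)
Require Import Defs.
From HB Require Import structures.
From mathcomp Require Import all_boot all_order all_algebra.
From mathcomp Require Import complex.
From mathcomp Require Import boolp classical_sets functions reals topology
  normedtype.
From mathcomp Require Import ring.

Import Order.TTheory GRing.Theory Num.Theory.
Import numFieldNormedType.Exports.

Local Open Scope classical_set_scope.
Local Open Scope ring_scope.

(** The heart of the proof is the identity
      phi(S F) phi(T) = phi(S) phi(F T)      for F of rank one,
    from which everything else is algebra in a prime ring.  Below, x (x) f is the
    operator rank_one x f, sending y to f(y) x.

    If S T = C and S E = 0, then S (T + E) = C as well, so comparing the two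
    values D gives phi(S) phi(E) = 0; symmetrically on the other side.  Thus
    phi preserves the zero products S E = 0 in which S is a left factor, or E a
    right factor, of C.  The finite rank of C lets every zero product having a
    factor of rank one be reduced to these.

    Let f be a bounded form with f o T = 0 and let z be a nonzero vector with
    T z = 0, C z = 0 and f z = 0.  Pick a form g with g z = 1 and put
    Q = 1 - z (x) g.  There is an involution U with f o U = g, and for a large
    scalar b the operator
      b U Q + T = U (b + U T) Q
    is still annihilated by f, while b + U T is invertible by completeness;
    since C = C Q, this operator is a right factor of C.  Hence
    phi(y (x) f) kills phi(b U Q + T) for all large b, and so it kills phi(T)
    (zero_product_rank_one_left).  The kernel of C is so large that the
    condition T z = 0 can be removed: for two independent vectors z1 and z2 in
    ker C and ker f, every T is a sum of an operator vanishing at z1 and one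
    vanishing at z2 (zero_product_kernel_form).  Exchanging the roles of vectors
    and forms, with forms that vanish on the range of C in place of vectors of
    its kernel, gives the statement for a right factor of rank one
    (zero_product_kernel_vector).  Applied to the splittings of S and T by an
    idempotent x (x) f, the two statements give the identity.

    In this argument the forms come from the Hahn-Banach theorem, proved here
    through minimal sublinear functions, and the inverse of b + U T comes from
    the fixed point of a contraction.

    Put alpha = phi(1).  The identity gives phi(F) phi(T) = alpha phi(F T), and
    then phi(F) kills both alpha a - a alpha and phi(S) phi(T) - alpha phi(S T).
    The elements killed by all the phi(F) form an ideal, which is zero because
    the algebra is prime.  So alpha is central and
    phi(S) phi(T) = alpha phi(S T); with phi(E) = 1 this reads
    1 = alpha phi(E^2), and alpha^-1 phi is the isomorphism. *)

(** * Transfer of products into a prime ring *)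

(** The right annihilator J of a A and the left annihilator I of A J are
    two-sided ideals with zero product, and they contain b and a. *)
Lemma prime_ring_mul_eq0 (A : pzRingType) (a b : A) :
  prime_ring A -> (forall r, a * r * b = 0) -> a = 0 \/ b = 0.
Proof.
move=> primeA ab0.
pose J : set A := [set y | forall r, a * r * y = 0].
pose I : set A := [set x | forall y, J y -> forall r, x * r * y = 0].
have idealJ : two_sided_ideal J.
  split=> [r|x y Jx Jy r|c x Jx r|c x Jx r]; first by rewrite mulr0.
  - by rewrite mulrBr Jx Jy subrr.
  - by rewrite mulrA -(mulrA a) Jx.
  - by rewrite mulrA Jx mul0r.
have idealI : two_sided_ideal I.
  split=> [y _ r|x x' Ix Ix' y Jy r|c x Ix y Jy r|c x Ix y Jy r].
  - by rewrite !mul0r.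
  - by rewrite !mulrBl Ix// Ix'// subrr.
  - by rewrite -2!mulrA (mulrA x) Ix// mulr0.
  - by rewrite -(mulrA x) Ix.
have [I0|/eqP I0] := pselect (I = [set 0]).
  by left; have : I a by []; rewrite I0.
have [J0|/eqP J0] := pselect (J = [set 0]).
  by right; have : J b by []; rewrite J0.
case: (primeA I J) => //; try exact/eqP.
rewrite eqEsubset; split=> [z [n [x [y [Ix Jy ->]]]]|_ ->].
  by apply: big1 => i _; rewrite -[x i]mulr1; apply: Ix.
exists 0, (fun=> 0), (fun=> 0); split=> [[]//|[]//|].
by rewrite big_ord0.
Qed.

Section PrimeTransfer.
Variables (B A : pzRingType) (phi : B -> A) (F : set B).
Hypothesis primeA : prime_ring A.
Hypothesis phi_surj : forall a, exists S, phi S = a.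
Hypothesis F_ideal : forall S T, F T -> F (S * T) /\ F (T * S).
Hypothesis F_nonzero : exists2 T, F T & phi T <> 0.
Hypothesis balanced : forall T S S', F T ->
  phi (S * T) * phi S' = phi S * phi (T * S').

Let phi_mull T S : F T -> phi T * phi S = phi 1 * phi (T * S).
Proof. by move=> FT; rewrite -balanced// mul1r. Qed.

(** The elements a annihilated by phi(F) are stable under left
    multiplication: phi T * phi S = phi 1 * phi (T * S) with T * S in F.  So one
    nonzero phi T has phi T * r * a = 0 for all r. *)
Lemma left_annihilated_eq0 (a : A) : (forall T, F T -> phi T * a = 0) -> a = 0.
Proof.
move=> Fa0; have [T FT T0] := F_nonzero.
have [r||//] := @prime_ring_mul_eq0 A (phi T) a primeA; last by [].
have [S <-] := phi_surj r.
by rewrite (phi_mull T)// -mulrA Fa0 ?mulr0//; case: (F_ideal S T FT).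
Qed.

Let comm1_ideal T : F T -> phi 1 * phi T = phi T * phi 1.
Proof. by move=> FT; rewrite (phi_mull T)// mulr1. Qed.

(** For T in F, both phi T * (phi 1 * phi S) and phi T * (phi S * phi 1) equal
    phi 1 * phi 1 * phi (T * S). *)
Lemma balanced_central (a : A) : GRing.comm (phi 1) a.
Proof.
have [S <-] := phi_surj a.
apply/eqP; rewrite -subr_eq0; apply/eqP/left_annihilated_eq0 => T FT.
have FTS : F (T * S) by case: (F_ideal S T FT).
rewrite mulrBr !mulrA -(comm1_ideal T)// -(mulrA (phi 1)) !(phi_mull T)//.
by rewrite -(mulrA _ (phi (T * S))) -comm1_ideal// subrr.
Qed.

(** For T in F, both phi T * (phi S * phi S') and
    phi T * (phi 1 * phi (S * S')) equal phi 1 * phi 1 * phi (T * S * S'). *)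
Lemma balanced_mul S S' : phi S * phi S' = phi 1 * phi (S * S').
Proof.
apply/eqP; rewrite -subr_eq0; apply/eqP/left_annihilated_eq0 => T FT.
have FTS : F (T * S) by case: (F_ideal S T FT).
rewrite mulrBr !mulrA (phi_mull T)// -(mulrA (phi 1)) (phi_mull (T * S))//.
rewrite -(comm1_ideal T)// -(mulrA (phi 1) (phi T)) (phi_mull T)//.
by rewrite !mulrA subrr.
Qed.

Lemma balanced_unit : exists b, b * phi 1 = 1 /\ phi 1 * b = 1.
Proof.
have [E E1] := phi_surj 1; exists (phi (E * E)).
by rewrite -balanced_central -balanced_mul E1 mulr1.
Qed.

End PrimeTransfer.

(** * Bounded forms and operators of rank one *)

Section BoundedForms.
Context {K : numFieldType} {X : normedModType K}.
Implicit Types (x y : X) (S T : bounded_operator X).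

Lemma operator_bound T : exists M : K, 0 <= M /\ forall x, `|T x| <= M * `|x|.
Proof.
case: T => f /= /bounded_linearP[_ [M fM]]; exists `|M|; split=> // x.
rewrite -[`|x|]normr_id -normrM ger0_norm//.
exact: le_trans (normr_ge0 _) (fM x).
Qed.

Record bounded_form := BoundedForm {
  bounded_form_fun :> X -> K;
  bounded_formP : forall a x y,
    bounded_form_fun (a *: x + y) = a * bounded_form_fun x + bounded_form_fun y;
  bounded_form_bound : exists M : K, forall x, `|bounded_form_fun x| <= M * `|x|
}.
Implicit Types f g : bounded_form.

Lemma form0 f : f 0 = 0.
Proof.
by have := bounded_formP f (-1) 0 0; rewrite scaler0 addr0 mulN1r addNr.
Qed.

Lemma formZ f a x : f (a *: x) = a * f x.
Proof. by have := bounded_formP f a x 0; rewrite form0 !addr0. Qed.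

Lemma formD f x y : f (x + y) = f x + f y.
Proof. by have := bounded_formP f 1 x y; rewrite scale1r mul1r. Qed.

Lemma formB f x y : f (x - y) = f x - f y.
Proof.
by have := bounded_formP f (-1) y x; rewrite scaleN1r mulN1r ![- _ + _]addrC.
Qed.

Lemma form_comp_subproof f T : exists M : K, forall x, `|f (T x)| <= M * `|x|.
Proof.
have [M fM] := bounded_form_bound f; have [N [N0 TN]] := operator_bound T.
exists (`|M| * N) => x; rewrite -mulrA (le_trans _ (ler_wpM2l _ (TN x)))//.
rewrite -[`|T x|]normr_id -normrM ger0_norm//.
exact: le_trans (normr_ge0 _) (fM _).
Qed.

Definition form_comp f T : bounded_form.
Proof.
refine (@BoundedForm (fun x => f (T x)) _ (form_comp_subproof f T)).
by move=> a x y; rewrite linearP bounded_formP.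
Defined.

Lemma form_sub_subproof f g (c : K) :
  exists M : K, forall x, `|f x - c * g x| <= M * `|x|.
Proof.
have [M fM] := bounded_form_bound f; have [N gN] := bounded_form_bound g.
exists (M + `|c| * N) => x; rewrite mulrDl (le_trans (ler_normB _ _))//.
by rewrite lerD// normrM -mulrA ler_wpM2l.
Qed.

Definition form_sub f g (c : K) : bounded_form.
Proof.
refine (@BoundedForm (fun x => f x - c * g x) _ (form_sub_subproof f g c)).
move=> a x y; rewrite !bounded_formP mulrBr mulrDr opprD addrACA.
by rewrite [c * (a * _)]mulrCA.
Defined.

Lemma rank_one_subproof x f : (fun y => f y *: x) \in bounded_linear (X := X).
Proof.
apply/bounded_linearP; split=> [a y z|].
  by rewrite bounded_formP scalerDl scalerA.
have [M fM] := bounded_form_bound f; exists (M * `|x|) => y.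
by rewrite normrZ mulrAC ler_wpM2r.
Qed.

Definition rank_one x f : bounded_operator X :=
  BoundedOperator (rank_one_subproof x f).

Lemma rank_oneE x f y : rank_one x f y = f y *: x.
Proof. by []. Qed.

Lemma bounded_operatorB S T x : (S - T) x = S x - T x.
Proof. by []. Qed.

(* The rule for S - T comes before the one for S + T, which also matches it. *)
Definition operatorE :=
  (@bounded_operator1 K X, @bounded_operatorM K X, bounded_operatorB,
   @bounded_operatorD K X, @bounded_operatorZ K X, rank_oneE).

Lemma mul_rank_one T x f : T * rank_one x f = rank_one (T x) f.
Proof. by apply: bounded_operatorP => y; rewrite !operatorE linearZ. Qed.

Lemma rank_one_mul T x f : rank_one x f * T = rank_one x (form_comp f T).
Proof. by apply: bounded_operatorP. Qed.

Lemma reflection_involutive x f :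
  f x = 2 -> (1 - rank_one x f) * (1 - rank_one x f) = 1.
Proof.
move=> fx; apply: bounded_operatorP => y; rewrite !operatorE formB formZ fx.
rewrite scalerBl mulr_natr mulr2n scalerDl.
by rewrite opprB addrK subrK.
Qed.

End BoundedForms.
Arguments bounded_form {K} X.

(** * Finitely spanned subspaces *)

Section FiniteSpan.
Context {K : fieldType} {V : lmodType K}.
Implicit Types (N : set V) (s : seq V).

(** The span of a list, by recursion on the list, so that adjoining a vector
    is a definitional step. *)
Fixpoint span_seq s : set V :=
  if s is v :: s' then [set x | exists c, span_seq s' (x - c *: v)]
  else [set 0].

Definition finitely_spanned N := exists s, N `<=` span_seq s.

Lemma span_seq_sum n (v : 'I_n -> V) c :
  span_seq (codom v) (\sum_(i < n) c i *: v i).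
Proof.
rewrite codomE /enum_mem -big_enum enumT /=.
elim: (Finite.enum _) => [|i e IHe] /=; first by rewrite big_nil.
by rewrite big_cons; exists (c i); rewrite addrC addrK.
Qed.

Lemma span_seq0 s : span_seq s 0.
Proof. by elim: s => //= v s IH; exists 0; rewrite scale0r subr0. Qed.

Lemma span_seqP a s x y :
  span_seq s x -> span_seq s y -> span_seq s (a *: x + y).
Proof.
elim: s x y => /= [x y -> ->|v s IH x y [c xc] [d yd]].
  by rewrite scaler0 addr0.
exists (a * c + d); rewrite scalerDl -scalerA opprD addrACA -scalerBr.
exact: IH.
Qed.

Lemma span_seqE s x : span_seq s x ->
  exists c : 'I_(size s) -> K, x = \sum_(i < size s) c i *: s`_i.
Proof.
elim: s x => [x ->|v s IH x [c /IH[d xd]]]; first by exists (fun=> 0); rewrite big_ord0.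
exists (fun i => if unlift ord0 i is Some j then d j else c).
rewrite big_ord_recl unlift_none /=; apply/eqP; rewrite addrC -subr_eq xd; apply/eqP.
by apply: eq_bigr => i _; rewrite liftK.
Qed.

Lemma not_finitely_spanned :
  ~ finite_dimensional [set: V] -> ~ finitely_spanned [set: V].
Proof.
move=> infV [s sV]; apply: infV; exists (size s), (fun i => s`_i).
rewrite eqEsubset; split=> // x _.
by have [c ->] := span_seqE s x (sV x I); exists c.
Qed.

End FiniteSpan.

(** By induction on the list s = v :: s': modulo the vectors of N that f sends
    into the span of s', the subspace N is spanned by at most one vector w. *)
Lemma infinite_kernel (K : fieldType) (V W : lmodType K) (f : V -> W)
    (N : set V) (s : seq W) :
  (forall a x y, f (a *: x + y) = a *: f x + f y) ->
  (forall a x y, N x -> N y -> N (a *: x + y)) ->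
  ~ finitely_spanned N -> (forall x, N x -> span_seq s (f x)) ->
  ~ finitely_spanned (N `&` [set x | f x = 0]).
Proof.
move=> flin; elim: s N => [|v s IH] N Nlin infN Nf.
  by rewrite (_ : _ `&` _ = N)// eqEsubset; split=> [x []//|x Nx]; split=> //; exact: Nf.
pose N' := N `&` [set x | span_seq s (f x)].
have N'lin a x y : N' x -> N' y -> N' (a *: x + y).
  move=> [Nx fx] [Ny fy]; split; first exact: Nlin.
  by rewrite /= flin; apply: span_seqP.
suff infN' : ~ finitely_spanned N'.
  have := IH N' N'lin infN' (fun x => @proj2 _ _).
  apply: contra_not => -[t tN]; exists t => x [[Nx _] fx].
  by apply: tN.
move=> [t tN']; apply: infN.
have [[w [Nw [c [/eqP c0 fw]]]]|noc] :=
    pselect (exists w, N w /\ exists c, c <> 0 /\ span_seq s (f w - c *: v)); last first.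
  exists t => x Nx; apply: tN'; split=> //=.
  have [c fx] := Nf x Nx; have [c0|/eqP c0] := eqVneq c 0.
    by rewrite c0 scale0r subr0 in fx.
  by case: noc; exists x; split=> //; exists c.
exists (w :: t) => x Nx; have [d fx] := Nf x Nx.
exists (d / c); apply: tN'; rewrite addrC -scaleNr; split; first exact: Nlin.
rewrite /= flin (_ : _ + _ = (- (d / c)) *: (f w - c *: v) + (f x - d *: v)).
  exact: span_seqP.
rewrite scalerBr scalerA mulNr divfK// !scaleNr opprK addrACA.
by rewrite subrr addr0.
Qed.

(** * Hahn-Banach theorem *)

Section Sublinear.
Local Open Scope complex_scope.
Context {R : realType} {V : lmodType R[i]}.
Implicit Types (p q r : V -> R) (x y : V).

Definition sublinear q :=
  (forall x y, q (x + y) <= q x + q y) /\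
  (forall t x, 0 < t -> q (t%:C *: x) <= t * q x).

Lemma sublinearZ q t x : sublinear q -> 0 <= t -> q (t%:C *: x) = t * q x.
Proof.
move=> [_ qZ].
have pos s y : 0 < s -> q (s%:C *: y) = s * q y.
  move=> s0; apply/eqP; rewrite eq_le qZ//= -ler_pdivlMl//.
  rewrite -[in leLHS](scale1r y) -(mulVf (_ : s%:C != 0)); last first.
    by rewrite fmorph_eq0 gt_eqF.
  by rewrite -fmorphV -scalerA qZ// invr_gt0.
rewrite le_eqVlt => /predU1P[<-|/pos//].
rewrite rmorph0 scale0r mul0r; have := pos 2 0 (ltr0Sn _ _).
rewrite scaler0 mulr_natl mulr2n => /eqP.
by rewrite -subr_eq0 opprD addNKr oppr_eq0 => /eqP.
Qed.

Lemma sublinear0 q : sublinear q -> q 0 = 0.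
Proof. by move=> q_sub; rewrite -(scale0r 0) (sublinearZ q 0)// mul0r. Qed.

Lemma sublinear_geN q x : sublinear q -> - q (- x) <= q x.
Proof.
move=> q_sub; rewrite lerNl -subr_ge0 opprK.
by rewrite -(sublinear0 q q_sub) -(addNr x); case: q_sub.
Qed.

(** The same directedness covers both uses: the infimum of a chain of sublinear
    functions, and the infimum over t of the functions in sublinear_slope. *)
Lemma sublinear_inf (I : Type) (i0 : I) (F : I -> V -> R) (m : V -> R) :
  (forall i x, m x <= F i x) ->
  (forall i j x y, exists k, F k (x + y) <= F i x + F j y) ->
  (forall i t x, 0 < t -> exists k, F k (t%:C *: x) <= t * F i x) ->
  exists q, sublinear q /\ forall i x, q x <= F i x.
Proof.
move=> Fm FD FZ; pose E x := [set F i x | i in [set: I]].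
have infE i x : inf (E x) <= F i x.
  by apply: ge_inf; [exists (m x) => _ [j _ <-]|exists i].
have Einf a x : (forall i, a <= F i x) -> a <= inf (E x).
  by move=> aF; apply: lb_le_inf; [exists (F i0 x), i0|move=> _ [i _ <-]].
exists (fun x => inf (E x)); split=> //; split=> [x y|t x t0].
  rewrite -lerBlDr; apply: (Einf) => i; rewrite lerBlDl -lerBlDr.
  apply: (Einf) => j; have [k Fk] := FD i j x y.
  by rewrite lerBlDl (le_trans (infE k _)).
rewrite -ler_pdivrMl//; apply: (Einf) => i; have [k Fk] := FZ i t x t0.
by rewrite ler_pdivrMl// (le_trans (infE k _)).
Qed.

(** The infimum over t >= 0 of q (x + t y) - t q y is sublinear and below q
    (t = 0), and it takes at - y a value at most - q y (t = 1). *)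
Lemma sublinear_slope q y : sublinear q ->
  exists r, [/\ sublinear r, forall x, r x <= q x & r (- y) <= - q y].
Proof.
move=> q_sub; have [qD qZ] := q_sub.
pose F (t : {t : R | 0 <= t}) x := q (x + (sval t)%:C *: y) - sval t * q y.
have t0 : 0 <= 0 :> R by []. have t1 : 0 <= 1 :> R by [].
have [||i t x t_gt0|r [r_sub rF]] :=
  @sublinear_inf _ (exist _ 0 t0) F (fun x => - q (- x)).
- move=> [t /= t_ge0] x; rewrite /F /= lerBrDl -lerBrDr opprK.
  rewrite -(sublinearZ q t y)//.
  by have := qD (x + t%:C *: y) (- x); rewrite addrAC subrr add0r.
- move=> [s /= s0] [t /= t_ge0] x z.
  exists (exist _ (s + t) (addr_ge0 s0 t_ge0)); rewrite /F /=.
  rewrite rmorphD /= scalerDl mulrDl addrACA opprD [leRHS]addrACA lerD2r.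
  exact: qD.
- case: i => s /= s0; exists (exist _ (t * s) (mulr_ge0 (ltW t_gt0) s0)).
  rewrite /F /= rmorphM /= -scalerA -scalerDr mulrBr mulrA lerD2r.
  exact: qZ.
exists r; split=> // [x|].
  apply: le_trans (rF (exist _ 0 t0) x) _.
  by rewrite /F /= rmorph0 scale0r mul0r addr0 subr0.
apply: le_trans (rF (exist _ 1 t1) (- y)) _.
by rewrite /F /= rmorph1 scale1r mul1r addNr (sublinear0 q q_sub) sub0r.
Qed.

(** A chain of sublinear functions below p is bounded below by - p (- x), so
    its infimum is sublinear and Zorn's lemma applies. *)
Lemma minimal_sublinear p : sublinear p ->
  exists q, [/\ sublinear q, forall x, q x <= p x &
    forall r, sublinear r -> (forall x, r x <= q x) -> forall x, q x <= r x].
Proof.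
move=> p_sub.
pose T := {q : V -> R | sublinear q /\ forall x, q x <= p x}.
pose below (q r : T) := `[< forall x, sval r x <= sval q x >].
have belowT : forall q r s : T, below q r -> below r s -> below q s.
  move=> q r s /asboolP qr /asboolP rs; apply/asboolP => x.
  exact: le_trans (rs x) (qr x).
have below_refl : forall q : T, below q q by move=> q; apply/asboolP.
pose p' : T := exist _ p (conj p_sub (fun x => lexx (p x))).
have chain (A : set T) : total_on A below -> exists q : T, forall r : T, A r -> below r q.
  move=> totA; have [A0|/set0P/negP/negPn/eqP ->] := pselect (A !=set0); last first.
    by exists p'.
  have [a Aa] := A0.
  have [|||q [q_sub qF]] := @sublinear_inf {q : T | A q} (exist _ a Aa)
      (fun b : {q : T | A q} => sval (sval b)) (fun x => - p (- x)).
  - move=> [[q [q_sub qp]] /= _] x; apply: le_trans (sublinear_geN q x q_sub).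
    by rewrite lerN2.
  - move=> [q Aq] [r Ar] x y /=.
    have [/asboolP qr|/asboolP rq] := totA q r Aq Ar.
      exists (exist _ r Ar) => /=; apply: le_trans (proj1 (proj1 (svalP r)) x y) _.
      exact: lerD.
    exists (exist _ q Aq) => /=; apply: le_trans (proj1 (proj1 (svalP q)) x y) _.
    exact: lerD.
  - by move=> [q Aq] t x t0; exists (exist _ q Aq); apply: (svalP q).1.2.
  have qp : forall x, q x <= p x.
    by move=> x; apply: le_trans (qF (exist _ a Aa) x) ((svalP a).2 x).
  exists (exist _ q (conj q_sub qp)) => r Ar; apply/asboolP => x.
  exact: (qF (exist _ r Ar) x).
have [[q [q_sub qp]] qmin] := ZL_preorder p' below_refl belowT chain.
exists q; split=> // r r_sub rq.
have rp x : r x <= p x by exact: le_trans (rq x) (qp x).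
by have /(_ _)/asboolP := qmin (exist _ r (conj r_sub rp)); apply; apply/asboolP.
Qed.

(** A minimal sublinear function equals all its slopes, hence is odd, and an odd
    sublinear function is additive.  Minimising below the slope of p in the
    direction z keeps the value at z at least p z. *)
Lemma minimal_sublinear_additive p z : sublinear p ->
  exists q : V -> R, [/\ forall x y, q (x + y) = q x + q y,
    forall (t : R) x, q (t%:C *: x) = t * q x,
    forall x, q x <= p x & p z <= q z].
Proof.
move=> p_sub; have [r [r_sub rp rz]] := sublinear_slope p z p_sub.
have [q [q_sub qr qmin]] := minimal_sublinear r r_sub.
have qN y : q (- y) = - q y.
  apply/eqP; rewrite eq_le; apply/andP; split; last first.
    by have := sublinear_geN q (- y) q_sub; rewrite opprK.
  have [s [s_sub sq sy]] := sublinear_slope q y q_sub.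
  exact: le_trans (qmin s s_sub sq (- y)) sy.
have qD x y : q (x + y) = q x + q y.
  apply/eqP; rewrite eq_le (proj1 q_sub)/=.
  by rewrite -lerBrDr -qN (le_trans _ (proj1 q_sub _ _))// addrK.
exists q; split=> // [t x|x|].
- have [t0|t0] := leP 0 t; first exact: sublinearZ.
  rewrite -[t]opprK rmorphN scaleNr qN mulNr.
  by rewrite (sublinearZ q (- t))// oppr_ge0 ltW.
- exact: le_trans (qr x) (rp x).
- by rewrite -lerN2 -qN (le_trans (qr _)).
Qed.

End Sublinear.

Section HahnBanach.
Local Open Scope complex_scope.
Context {R : realType} {X : normedModType R[i]}.

Definition real_norm (x : X) : R := complex.Re `|x|.

Lemma real_normE x : (real_norm x)%:C = `|x|.
Proof. exact/RRe_real/normr_real. Qed.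

Lemma sublinear_real_norm : sublinear real_norm.
Proof.
split=> [x y|t x t0]; first by rewrite -lecR rmorphD /= !real_normE ler_normD.
rewrite -lecR rmorphM /= !real_normE normrZ.
by rewrite ger0_norm// ler0c ltW.
Qed.

(** A real-linear q below the norm with q z >= |z| is the real part of the
    complex-linear form x |-> q x - i q (i x), which is bounded by 2 |x|; only
    its nonvanishing at z is needed, as the form is then rescaled. *)
Lemma exists_bounded_form (z : X) : z <> 0 ->
  exists f : bounded_form X, f z = 1.
Proof.
move=> z0.
have [q [qD qZ qle zq]] := minimal_sublinear_additive _ z sublinear_real_norm.
pose f x : R[i] := q x -i* q ('i *: x).
have flin a x y : f (a *: x + y) = a * f x + f y.
  have qC b u : q (b *: u) = complex.Re b * q u + complex.Im b * q ('i *: u).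
    by rewrite {1}[b]complexE scalerDl qD qZ ['i%C * _]mulrC -scalerA qZ.
  rewrite /f scalerDr scalerA !qD (qC a) (qC ('i%C * a)) ['i%C * a]mulrC ReiNIm ImiRe.
  case: a => s t /=; simpc.
  by rewrite [t * _ - _]addrC.
have fbound : exists M : R[i], forall x, `|f x| <= M * `|x|.
  have qN x : `|(q x)%:C| <= `|x|.
    rewrite -real_normE ?normc_real normc_def /= expr0n /= addr0 sqrtr_sqr lecR.
    rewrite ler_norml qle andbT lerNl -mulN1r -qZ.
    rewrite rmorphN1 scaleN1r (le_trans (qle _))//.
    by rewrite /real_norm normrN.
  exists 2 => x; rewrite (_ : f x = (q x)%:C - 'i * (q ('i *: x))%:C); last first.
    by rewrite [LHS]complexE /= rmorphN mulrN.
  have normi : `|'i%C : R[i]| = 1 by rewrite normc_def /= expr0n expr1n add0r sqrtr1.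
  rewrite mulr_natl mulr2n (le_trans (ler_normB _ _))// lerD//.
  by rewrite normrM normi mul1r (le_trans (qN _))// normrZ normi mul1r.
have fz : f z != 0.
  apply/eqP => /(congr1 (@complex.Re R)) /= qz0.
  have : (real_norm z)%:C <= 0 by rewrite lecR -qz0.
  by rewrite real_normE normr_le0 => /eqP.
(* f - (1 - (f z)^-1) f is the multiple (f z)^-1 f. *)
exists (form_sub (BoundedForm f flin fbound) (BoundedForm f flin fbound) (1 - (f z)^-1)).
by rewrite /= mulrBl mul1r mulVf// opprB addrC subrK.
Qed.

End HahnBanach.

(** By induction on s = v :: s': let f separate z from the span of s'.  If f
    does not vanish at v, let g separate z - (f v)^-1 v from that span;
    then g - (g v / f v) f vanishes at v too and keeps the value 1 at z. *)
Lemma exists_separating_form (R : realType) (X : normedModType R[i])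
    (s : seq X) (z : X) : ~ span_seq s z ->
  exists f : bounded_form X, f z = 1 /\ forall x, span_seq s x -> f x = 0.
Proof.
elim: s z => [|v s IH] z sz.
  by have [f fz] := exists_bounded_form z sz; exists f; split=> // x ->; rewrite form0.
have [|f [fz fs]] := IH z.
  by apply: contra_not sz => sz; exists 0; rewrite scale0r subr0.
have [fv|fv] := eqVneq (f v) 0.
  exists f; split=> // x [c /fs]; rewrite formB formZ fv mulr0 subr0.
  exact.
have [|g [gz gs]] := IH (z - (f v)^-1 *: v).
  by apply: contra_not sz => sz; exists (f v)^-1.
exists (form_sub g f (g v / f v)); split=> /=.
  by rewrite -gz formB formZ fz mulr1 mulrC.
move=> x [c sx]; have := gs _ sx; have := fs _ sx.
rewrite !formB !formZ => /eqP; rewrite subr_eq0 => /eqP -> /eqP.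
by rewrite subr_eq0 => /eqP ->; rewrite mulrCA divfK// subrr.
Qed.

(** * Invertibility of large scalar shifts *)

Section Neumann.
Local Open Scope complex_scope.
Context {R : realType} {X : completeNormedModType R[i]}.

(** Two points are at distance at most twice the sum of their displacements
    under f.  The displacements of the iterates tend to 0, so the iterates form
    a Cauchy sequence, and their limit has displacement 0. *)
Lemma half_contraction_fixed (f : X -> X) :
  (forall x y, `|f x - f y| <= 2^-1 * `|x - y|) -> exists p, f p = p.
Proof.
move=> fh; pose u n := iter n f 0.
have small (e : R[i]) : 0 < e ->
    exists N, forall n, (N <= n)%N -> `|u n - f (u n)| < e.
  move=> e0; pose c := real_norm (u 0%N - f (u 0%N)).
  have step n : `|u n - f (u n)| <= (2^-1 ^+ n * c)%:C.
    elim: n => [|n IH]; first by rewrite expr0 mul1r real_normE.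
    apply: le_trans (fh _ _) _; rewrite exprS -mulrA rmorphM fmorphV /= rmorph_nat.
    by rewrite ler_wpM2l// invr_ge0.
  have eE : e = (complex.Re e)%:C by rewrite RRe_real ?gtr0_real.
  have re0 : 0 < complex.Re e by rewrite -ltcR -eE.
  exists (Num.bound (c / complex.Re e)) => n /upper_nthrootP cn.
  rewrite (le_lt_trans (step n))// eE ltcR exprVn mulrC ltr_pdivrMr ?exprn_gt0//.
  by rewrite mulrC -ltr_pdivrMr.
have near_fixed x y : `|x - y| <= 2 * (`|x - f x| + `|y - f y|).
  rewrite -ler_pdivrMl//.
  have := ler_distD (f x) x y.
  have := ler_distD (f y) (f x) y.
  have := fh x y; rewrite [`|f y - y|]distrC => h1 h2 h3.
  have : `|x - y| <= `|x - f x| + (2^-1 * `|x - y| + `|y - f y|).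
    by rewrite (le_trans h3)// lerD2l (le_trans h2)// lerD2r.
  rewrite addrCA -lerBlDl; congr (_ <= _).
  by rewrite {1}(splitr `|x - y|) mulrC addrK.
have cvgu : cvg (u @ \oo).
  apply/cauchy_cvgP/cauchy_exP => e e0.
  have [N uN] : exists N, forall n, (N <= n)%N -> `|u n - f (u n)| < e / 4.
    by apply: small; rewrite divr_gt0.
  exists (u N), N => // n /= Nn; rewrite -ball_normE /=.
  rewrite (le_lt_trans (near_fixed _ _))//.
  rewrite -ltr_pdivlMl// (lt_le_trans (ltrD (uN N _) (uN n Nn)))//.
  by rewrite le_eqVlt; apply/orP; left; apply/eqP; field.
exists (limn u); apply/eqP; rewrite eq_sym -subr_eq0 -normr_le0.
apply/ler_addgt0Pr => e e0; rewrite add0r.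
have [N uN] := small _ (divr_gt0 e0 (ltr0n _ 3)).
have /cvgrPdist_lt/(_ (e / 3)) := cvgu.
rewrite divr_gt0// => /(_ isT)[M _ uM].
pose n := maxn N M.
have h1 := uN n (leq_maxl _ _).
have h2 : `|limn u - u n| < e / 3 by apply: uM; exact: leq_maxr.
have h3 := fh (u n) (limn u).
rewrite distrC (le_trans (ler_distD (u n) _ _))//.
rewrite [e](_ : _ = e / 3 + (e / 3 + e / 3)); last by field.
rewrite [leLHS]addrC (distrC (u n)) (lerD (ltW h2))//.
rewrite (le_trans (ler_distD (f (u n)) _ _))//.
rewrite [`|f (u n) - u n|]distrC lerD ?(ltW h1)// distrC (le_trans h3)//.
rewrite distrC (le_trans _ (ltW h2))// ler_piMl// invf_le1// ler1n//.
Qed.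

(** Let M bound T.  For b >= 2 M + 1, solving b x + T x = y amounts to finding a
    fixed point of x |-> b^-1 (y - T x), a contraction of ratio at most 1/2. *)
Lemma invertible_shift (T : bounded_operator X) : exists2 a : R[i], 0 < a &
  forall b : R[i], a <= b -> exists W : bounded_operator X,
    W * (b *: (1 : bounded_operator X) + T) = 1 /\
    (b *: (1 : bounded_operator X) + T) * W = 1.
Proof.
have [M [M0 TM]] := operator_bound T.
exists (2 * M + 1) => [|b ab]; first by rewrite ltr_wpDl// mulr_ge0.
have b0 : 0 < b by apply: lt_le_trans ab; rewrite ltr_wpDl// mulr_ge0.
have Mb : M <= 2^-1 * b.
  by rewrite ler_pdivlMl// (le_trans _ ab)// lerDl.
have opE x : (b *: (1 : bounded_operator X) + T) x = b *: x + T x by [].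
have below x : `|x| <= 2 / b * `|b *: x + T x|.
  rewrite mulrAC ler_pdivlMr// mulrC -ler_pdivrMl//.
  have := lerB_normD (b *: x) (T x).
  apply: le_trans; rewrite normrZ gtr0_norm// lerBrDr.
  rewrite (le_trans (lerD (lexx _) (TM x)))//.
  rewrite (le_trans (lerD (lexx _) (ler_wpM2r _ Mb)))//.
  by rewrite le_eqVlt; apply/orP; left; apply/eqP; field.
have inj x y : b *: x + T x = b *: y + T y -> x = y.
  move=> xy; apply/eqP; rewrite -subr_eq0 -normr_le0 (le_trans (below _))//.
  by rewrite scalerBr (linearB T) addrACA -opprD xy subrr normr0 mulr0.
have surj y : exists x, b *: x + T x = y.
  have [x x'|p pE] := @half_contraction_fixed (fun x => b^-1 *: (y - T x)).
    rewrite /= -scalerBr opprB addrC addrA subrK.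
    rewrite -(linearB T) normrZ gtr0_norm ?invr_gt0// ler_pdivrMl// mulrA.
    by rewrite (le_trans (TM _))// distrC ler_wpM2r// [b * _]mulrC.
  by exists p; rewrite -{1}pE scalerA mulfV ?gt_eqF// scale1r subrK.
have [W WE] := choice surj.
have WP : W \in bounded_linear (X := X).
  apply/bounded_linearP; split=> [c x y|].
    apply: inj; rewrite WE (linearP T) scalerDr scalerA mulrC -scalerA.
    by rewrite addrACA -scalerDr !WE.
  by exists (2 / b) => y; rewrite -{2}(WE y).
exists (BoundedOperator WP); split; apply: bounded_operatorP => x.
  by apply: inj; rewrite bounded_operatorM /= WE.
by rewrite bounded_operatorM opE /= WE.
Qed.

End Neumann.

(** * Zero products with a factor of rank one *)

Section ZeroProducts.
Local Open Scope complex_scope.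
Context {R : realType} {A : algType R[i]} {X : completeNormedModType R[i]}.
Variables (C : bounded_operator X) (D : A)
  (phi : {linear bounded_operator X -> A}).
Hypothesis phi_factor :
  forall S T : bounded_operator X, S * T = C -> phi S * phi T = D.
Implicit Types (S T U Q W : bounded_operator X) (x y z : X).
Implicit Types (f g h : bounded_form X).

Lemma left_factor_zero_product S T E :
  S * T = C -> S * E = 0 -> phi S * phi E = 0.
Proof.
move=> ST SE; have := phi_factor S (T + E); rewrite mulrDr ST SE addr0 => /(_ erefl).
rewrite linearD mulrDr (phi_factor S T)//.
by rewrite -[RHS]addr0 => /addrI.
Qed.

Lemma right_factor_zero_product S T E :
  S * T = C -> E * T = 0 -> phi E * phi T = 0.
Proof.
move=> ST ET; have := phi_factor (S + E) T; rewrite mulrDl ST ET addr0 => /(_ erefl).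
rewrite linearD mulrDl (phi_factor S T)//.
by rewrite -[RHS]addr0 => /addrI.
Qed.

Lemma affine_eq0 (a : R[i]) (u v : A) :
  a *: u + v = 0 -> (2 * a) *: u + v = 0 -> v = 0.
Proof.
move=> e1 e2; have : 2 *: (a *: u + v) - ((2 * a) *: u + v) = 0.
  by rewrite e1 e2 scaler0 subr0.
rewrite scalerDr scalerA opprD addrACA subrr add0r.
by rewrite -[X in _ - X]scale1r -scalerBl -[2]/(1 + 1) addrK scale1r.
Qed.

Lemma shift_mul (b : R[i]) S T :
  (b *: (1 : bounded_operator X) + S) * T = b *: T + S * T.
Proof. by apply: bounded_operatorP. Qed.

Lemma mul_scale (b : R[i]) S T : S * (b *: T) = b *: (S * T).
Proof. by apply: bounded_operatorP => x; rewrite !operatorE linearZ. Qed.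

Lemma mul_shift (b : R[i]) S T :
  T * (b *: (1 : bounded_operator X) + S) = b *: T + T * S.
Proof. by rewrite mulrDr mul_scale mulr1. Qed.

(** The operator b U Q + T = U (b + U T) Q is a right factor of C = C Q as soon
    as b + U T is invertible, and S annihilates it.  So phi S kills
    b phi (U Q) + phi T for all large b. *)
Lemma zero_product_right_corner S T U Q :
  U * U = 1 -> C * Q = C -> T * Q = T -> S * T = 0 -> S * (U * Q) = 0 ->
  phi S * phi T = 0.
Proof.
move=> UU CQ TQ ST SUQ.
have [a a0 inv] := invertible_shift (U * T).
have shifted b : a <= b -> b *: (phi S * phi (U * Q)) + phi S * phi T = 0.
  move=> /inv[W [WN _]].
  rewrite scalerAr -mulrDr -linearZ -linearD.
  apply: (right_factor_zero_product (C * (W * U))).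
    rewrite (_ : _ + _ = U * ((b *: (1 : bounded_operator X) + U * T) * Q)).
      by rewrite -!mulrA (mulrA U U) UU mul1r (mulrA W) WN mul1r.
    by rewrite shift_mul mulrDr mul_scale -mulrA TQ mulrA UU mul1r.
  by rewrite mulrDr mul_scale ST SUQ scaler0 addr0.
apply: (affine_eq0 a (phi S * phi (U * Q))); apply: shifted => //.
by rewrite mulr_natl mulr2n lerDl ltW.
Qed.

(** Mirror image of zero_product_right_corner, with the left factor
    b Q U + S = Q (b + S U) U of C = Q C. *)
Lemma zero_product_left_corner S T U Q :
  U * U = 1 -> Q * C = C -> Q * S = S -> S * T = 0 -> Q * U * T = 0 ->
  phi S * phi T = 0.
Proof.
move=> UU QC QS ST QUT.
have [a a0 inv] := invertible_shift (S * U).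
have shifted b : a <= b -> b *: (phi (Q * U) * phi T) + phi S * phi T = 0.
  move=> /inv[W [_ NW]].
  rewrite scalerAl -mulrDl -linearZ -linearD.
  apply: (left_factor_zero_product _ (U * (W * C))).
    rewrite (_ : _ + _ = Q * ((b *: (1 : bounded_operator X) + S * U) * U)).
      by rewrite -!mulrA (mulrA U U) UU mul1r (mulrA _ W) NW mul1r.
    by rewrite shift_mul mulrDr mul_scale -mulrA UU mulr1 QS.
  rewrite mulrDl ST addr0; apply: bounded_operatorP => x.
  rewrite [LHS](_ : _ = b *: (Q * U * T) x)// QUT.
  exact: scaler0.
apply: (affine_eq0 a (phi (Q * U) * phi T)); apply: shifted => //.
by rewrite mulr_natl mulr2n lerDl ltW.
Qed.

(** With g z = f w' = 1 and g w' = f z = 0, the reflection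
    U = 1 - (z - w') (x) (g - f) exchanges z and w', and f and g; so f vanishes
    on the range of U Q, where Q = 1 - z (x) g projects onto ker g along z. *)
Lemma zero_product_rank_one_left y f w z T :
  f w = 1 -> z <> 0 -> C z = 0 -> f z = 0 -> T z = 0 ->
  (forall x, f (T x) = 0) -> phi (rank_one y f) * phi T = 0.
Proof.
move=> fw z0 Cz fz Tz fT.
have [g gz] := exists_bounded_form z z0.
have [w' [fw' gw']] : exists w', f w' = 1 /\ g w' = 0.
  by exists (w - g w *: z); rewrite !formB !formZ gz fz mulr1 mulr0 subrr subr0.
pose k := form_sub g f 1.
have kE x : k x = g x - f x by rewrite /= mul1r.
apply: (zero_product_right_corner _ _
  (1 - rank_one (z - w') k) (1 - rank_one z g)).
- apply: reflection_involutive.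
  by rewrite kE !formB gz gw' fz fw' subr0 sub0r opprK.
- apply: bounded_operatorP => x; rewrite !operatorE.
  by rewrite linearB linearZ /= Cz scaler0 subr0.
- apply: bounded_operatorP => x; rewrite !operatorE.
  by rewrite linearB linearZ /= Tz scaler0 subr0.
- by apply: bounded_operatorP => x; rewrite !operatorE fT scale0r.
apply: bounded_operatorP => x; rewrite !operatorE.
rewrite formB formZ kE !formB !formZ fz fw' gz mulr1 mulr0 subrr subr0.
rewrite !sub0r mulrN1 opprK.
by rewrite addrN scale0r.
Qed.

(** Dually, U = 1 - (x - y') (x) (f - g) carries x to the vector y' that
    Q = 1 - y' (x) g annihilates. *)
Lemma zero_product_rank_one_right x h f y g S :
  f x = 1 -> g y = 1 -> g x = 0 -> (forall z, g (C z) = 0) ->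
  (forall z, g (S z) = 0) -> S x = 0 -> phi S * phi (rank_one x h) = 0.
Proof.
move=> fx gy gx gC gS Sx.
have [y' [gy' fy']] : exists y', g y' = 1 /\ f y' = 0.
  by exists (y - f y *: x); rewrite !formB !formZ fx gx mulr1 mulr0 subrr subr0.
pose k := form_sub f g 1.
have kE z : k z = f z - g z by rewrite /= mul1r.
apply: (zero_product_left_corner _ _
  (1 - rank_one (x - y') k) (1 - rank_one y' g)).
- apply: reflection_involutive.
  by rewrite kE !formB gy' fy' gx fx subr0 sub0r opprK.
- by apply: bounded_operatorP => z; rewrite !operatorE gC scale0r subr0.
- by apply: bounded_operatorP => z; rewrite !operatorE gS scale0r subr0.
- by apply: bounded_operatorP => z; rewrite !operatorE linearZ /= Sx scaler0.
rewrite mul_rank_one; apply: bounded_operatorP => z; rewrite !operatorE.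
rewrite (_ : x - k x *: (x - y') = y'); last first.
  by rewrite kE fx gx subr0 scale1r opprB addrC subrK.
by rewrite gy' scale1r subrr scaler0.
Qed.

Hypothesis infX : ~ finite_dimensional [set: X].
Hypothesis finC : finite_rank C.

Lemma finite_rank_span : exists s, forall x, span_seq s (C x).
Proof.
have [n [v rC]] := finC; exists (codom v) => x.
have : range C (C x) by exists x.
by rewrite rC => -[c _ <-]; exact: span_seq_sum.
Qed.

(** Each of C, f and g has finite rank, so restricting to its kernel keeps a
    subspace infinite-dimensional (infinite_kernel). *)
Lemma exists_common_kernel f g :
  exists z, [/\ z <> 0, C z = 0, f z = 0 & g z = 0].
Proof.
have [s sC] := finite_rank_span.
have span1 (k : R[i]) : span_seq [:: (1 : R[i]^o)] k.
  by exists k; rewrite /GRing.scale /= mulr1 subrr.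
have inf1 := infinite_kernel _ _ _ C setT s (linearP C) (fun _ _ _ _ _ => I)
  (not_finitely_spanned infX) (fun x _ => sC x).
have lin1 a x y : ([set: X] `&` [set x | C x = 0]) x ->
    ([set: X] `&` [set x | C x = 0]) y ->
    ([set: X] `&` [set x | C x = 0]) (a *: x + y).
  by move=> [_ /= Cx] [_ /= Cy]; split=> //=; rewrite linearP /= Cx Cy scaler0 addr0.
have inf2 := infinite_kernel _ _ R[i]^o f _ _ (bounded_formP f) lin1 inf1
  (fun x _ => span1 (f x)).
set N := (X in ~ finitely_spanned X) in inf2.
have lin2 a x y : N x -> N y -> N (a *: x + y).
  move=> [Nx /= fx] [Ny /= fy]; split=> /=; first exact: lin1.
  by rewrite bounded_formP fx fy mulr0 addr0.
have inf3 := infinite_kernel _ _ R[i]^o g _ _ (bounded_formP g) lin2 inf2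
  (fun x _ => span1 (g x)).
apply: contrapT => noz; apply: inf3; exists [::] => x [[[_ Cx] fx] gx].
by apply: contrapT => x0; apply: noz; exists x.
Qed.

Lemma exists_common_annihilator x y :
  exists g z, [/\ g z = 1, forall v, g (C v) = 0, g x = 0 & g y = 0].
Proof.
have [s sC] := finite_rank_span.
have [z sz] : exists z, ~ span_seq [:: x, y & s] z.
  apply: contrapT => noz; apply: (not_finitely_spanned infX).
  exists [:: x, y & s] => z _; apply: contrapT => sz; apply: noz.
  by exists z.
have [g [gz gs]] := exists_separating_form R X _ z sz.
exists g, z; split=> // [v||]; apply: gs.
- by exists 0; rewrite scale0r subr0; exists 0; rewrite scale0r subr0.
- by exists 1; rewrite scale1r subrr; exact: span_seq0.
- by exists 0; rewrite scale0r subr0; exists 1; rewrite scale1r subrr; exact: span_seq0.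
Qed.

(** For independent z1 and z2 in ker C and ker f, with h z1 = 1 and h z2 = 0,
    the operator T - T z1 (x) h vanishes at z1, and T z1 (x) h at z2. *)
Lemma zero_product_kernel_form y f w T :
  f w = 1 -> (forall x, f (T x) = 0) -> phi (rank_one y f) * phi T = 0.
Proof.
move=> fw fT.
have [z1 [z1n0 Cz1 fz1 _]] := exists_common_kernel f f.
have [h hz1] := exists_bounded_form z1 z1n0.
have [z2 [z2n0 Cz2 fz2 hz2]] := exists_common_kernel f h.
have -> : T = (T - rank_one (T z1) h) + rank_one (T z1) h by rewrite subrK.
rewrite linearD mulrDr; set a := _ * _; set b := _ * _.
suff [-> ->] : a = 0 /\ b = 0 by rewrite addr0.
split.
- apply: (zero_product_rank_one_left y f w z1) => // [|x]; rewrite !operatorE.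
    by rewrite hz1 scale1r subrr.
  by rewrite formB formZ !fT mulr0 subr0.
- apply: (zero_product_rank_one_left y f w z2) => // [|x]; rewrite !operatorE.
    by rewrite hz2 scale0r.
  by rewrite formZ fT mulr0.
Qed.

(** Dually, with g1 y1 = 1 and g2 y1 = 0 for forms g1 and g2 that vanish at x
    and on the range of C, the form g1 vanishes on the range of
    S - y1 (x) (g1 o S), and g2 on that of y1 (x) (g1 o S). *)
Lemma zero_product_kernel_vector x h f S :
  f x = 1 -> S x = 0 -> phi S * phi (rank_one x h) = 0.
Proof.
move=> fx Sx.
have [g1 [y1 [g1y1 g1C g1x _]]] := exists_common_annihilator x x.
have [g2 [y2 [g2y2 g2C g2x g2y1]]] := exists_common_annihilator x y1.
have -> : S = (S - rank_one y1 (form_comp g1 S)) + rank_one y1 (form_comp g1 S).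
  by rewrite subrK.
rewrite linearD mulrDl; set a := _ * _; set b := _ * _.
suff [-> ->] : a = 0 /\ b = 0 by rewrite addr0.
split.
- apply: (zero_product_rank_one_right x h f y1 g1) => // [z|]; rewrite !operatorE /=.
    by rewrite formB formZ g1y1 mulr1 subrr.
  by rewrite Sx form0 scale0r subr0.
- apply: (zero_product_rank_one_right x h f y2 g2) => // [z|]; rewrite !operatorE /=.
    by rewrite formZ g2y1 mulr0.
  by rewrite Sx form0 scale0r.
Qed.

(** For the idempotent P = x (x) f, the products (S P) (T - P T) and
    (S - S P) (P T) are zero and each has a factor of rank one. *)
Lemma balanced_idempotent x f S T : f x = 1 ->
  phi (S * rank_one x f) * phi T = phi S * phi (rank_one x f * T).
Proof.
move=> fx; set P := rank_one x f.
have h1 : phi (S * P) * phi (T - P * T) = 0.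
  rewrite mul_rank_one; apply: (zero_product_kernel_form _ f x _ fx) => z.
  by rewrite !operatorE formB formZ fx mulr1 subrr.
have h2 : phi (S - S * P) * phi (P * T) = 0.
  rewrite rank_one_mul; apply: (zero_product_kernel_vector _ _ f _ fx).
  by rewrite !operatorE fx scale1r subrr.
move: h1 h2; rewrite !linearB mulrBr mulrBl => /eqP; rewrite subr_eq0 => /eqP ->.
by move=> /eqP; rewrite subr_eq0 => /eqP.
Qed.

(** Both sides are linear in the operator of rank one, and x (x) f is a
    combination of the idempotents (x + (1 - f x) w) (x) f and w (x) f, where
    f w = 1. *)
Lemma balanced_rank_one x f S T :
  phi (S * rank_one x f) * phi T = phi S * phi (rank_one x f * T).
Proof.
have [[w fw]|nof] := pselect (exists w, f w = 1); last first.
  have f0 z : f z = 0.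
    apply/eqP/negP => /negP fz; apply: nof; exists ((f z)^-1 *: z).
    by rewrite formZ mulVf.
  have -> : rank_one x f = 0.
    by apply: bounded_operatorP => z; rewrite !operatorE f0 scale0r.
  by rewrite mulr0 mul0r !linear0 mulr0 mul0r.
have -> : rank_one x f = rank_one (x + (1 - f x) *: w) f - (1 - f x) *: rank_one w f.
  by apply: bounded_operatorP => z; rewrite !operatorE scalerDr !scalerA mulrC addrK.
rewrite mulrBr mulrBl mul_scale.
rewrite (_ : (_ *: rank_one w f) * T = (1 - f x) *: (rank_one w f * T)); last first.
  exact: bounded_operatorP.
rewrite !(linearB phi) !(linearZZ phi) mulrBl mulrBr -scalerAl -scalerAr.
rewrite !balanced_idempotent//.
by rewrite formD formZ fw mulr1 addrC subrK.
Qed.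

End ZeroProducts.

(** * Conclusion *)

Theorem theorem2p2 (R : realType) (A : algType R[i])
    (X : completeNormedModType R[i])
    (C : bounded_operator X) (D : A)
    (phi : {linear bounded_operator X -> A}) :
  prime_ring A ->
  ~ finite_dimensional [set: X] ->
  finite_rank C ->
  bijective phi ->
  (forall S T : bounded_operator X, S * T = C -> phi S * phi T = D) ->
  [/\ exists b : A, b * phi 1 = 1 /\ phi 1 * b = 1,
      forall a : A, GRing.comm (phi 1) a
    & exists Phi : {rmorphism bounded_operator X -> A},
        [/\ scalable Phi, bijective Phi
          & forall T : bounded_operator X, phi T = phi 1 * Phi T]].
Proof.
move=> primeA infX finC [psi phiK psiK] phi_factor.
pose F : set (bounded_operator X) := [set T | exists x f, T = rank_one x f].
have F_ideal S T : F T -> F (S * T) /\ F (T * S).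
  move=> [x [f ->]]; rewrite mul_rank_one rank_one_mul.
  by split; [exists (S x), f|exists x, (form_comp f S)].
have phi_surj a : exists S, phi S = a by exists (psi a).
have F_nonzero : exists2 T, F T & phi T <> 0.
  have [g [x [gx _ _ _]]] := exists_common_annihilator C infX finC 0 0.
  exists (rank_one x g) => [|phi0]; first by exists x, g.
  have /(congr1 (fun T => g (bounded_operator_fun T x))) : rank_one x g = 0.
    by apply: (can_inj phiK); rewrite phi0 linear0.
  rewrite !operatorE formZ gx mulr1 form0 => /eqP.
  by rewrite oner_eq0.
have balanced T S S' : F T -> phi (S * T) * phi S' = phi S * phi (T * S').
  by move=> [x [f ->]]; exact: (balanced_rank_one C D).
have central := balanced_central _ _ phi F primeA phi_surj F_ideal F_nonzero balanced.
have phiM := balanced_mul _ _ phi F primeA phi_surj F_ideal F_nonzero balanced.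
have [b [b1 b2]] := balanced_unit _ _ phi F primeA phi_surj F_ideal F_nonzero balanced.
split=> //; first by exists b.
have bC a : b * a = a * b.
  by rewrite -[a in RHS]mul1r -b1 -(mulrA b) (central a) -!mulrA b2 mulr1.
pose Phi T := b * phi T.
have PhiB : zmod_morphism Phi by move=> S T; rewrite /Phi linearB mulrBr.
have PhiM : monoid_morphism Phi.
  split=> [|S T]; first exact: b1.
  rewrite /Phi -(mulrA b) (mulrA (phi S)) -(bC (phi S)) -!mulrA phiM.
  by rewrite (mulrA b (phi 1)) b1 mul1r.
pose PhiZ := GRing.isZmodMorphism.Build _ _ Phi PhiB.
pose PhiR := GRing.isMonoidMorphism.Build _ _ Phi PhiM.
pose Phi' : {rmorphism bounded_operator X -> A} := HB.pack Phi PhiZ PhiR.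
exists Phi'; split=> [a T||T] /=.
- by rewrite /Phi linearZ /= scalerAr.
- exists (fun a => psi (phi 1 * a)) => [T|a]; rewrite /Phi.
    by rewrite mulrA b2 mul1r phiK.
  by rewrite psiK mulrA b1 mul1r.
- by rewrite /Phi mulrA b2 mul1r.
Qed.
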